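(* Let $A$ be a real symmetric $n\times n$ matrix whose minimum eigenvalue $\lambda_1$ satisfies $\lambda_1<0$, let $b\in\mathbb{R}^n$ and $\rho>0$. Consider the problem $$\text{(CRS)}\qquad \min_{x\in\mathbb{R}^n}\ f_1(x):=\tfrac12 x^TAx+b^Tx+\tfrac{\rho}{3}\|x\|^3$$ and the problem $$\text{(CP)}\qquad \min_{x\in\mathbb{R}^n,\,y\in\mathbb{R}}\ f_2(x,y):=\tfrac12 x^T(A-\lambda_1 I)x+b^Tx+\tfrac{\rho}{3}y^{3/2}+\tfrac{\lambda_1}{2}y\quad\text{subject to } \|x\|^2\le y .$$ Then (CRS) is equivalent to (CP) in the following sense. (1) The two problems have the same optimal value. (2) If $x^*$ is an optimal solution to (CRS), then $(x^*,\|x^*\|^2)$ is an optimal solution to (CP). (3) If $(\tilde x,\tilde y)$ is an optimal solution to (CP), then an optimal solution to (CRS) is given by $$\hat x=\begin{cases}\tilde x & \text{if }\|\tilde x\|^2=\tilde y,\\ \tilde x+\zeta v & \text{if }\|\tilde x\|^2<\tilde y,\end{cases}$$ where $v$ is an eigenvector of $A$ associated with $\lambda_1$ and $\zeta$ is a root of the quadratic equation $\|\tilde x+\zeta v\|^2=\tilde y$ (in the unknown $\zeta$).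
   Context: $\|\cdot\|$ denotes the Euclidean norm and $I$ the identity matrix. The matrix $A$ is not assumed positive semidefinite. *)

(* Defs.v *)
From HB Require Import structures.
From mathcomp Require Import all_boot all_order all_algebra.
From mathcomp Require Import all_classical all_reals all_analysis.

Set Implicit Arguments.
Unset Strict Implicit.
Unset Printing Implicit Defensive.

Import Order.TTheory GRing.Theory Num.Theory.

Local Open Scope classical_set_scope.
Local Open Scope ring_scope.

(* The canonical norm `|x| on 'cV[R]_n is the sup norm, hence this one. *)
Definition enorm (R : realType) (n : nat) (x : 'cV[R]_n) : R :=
  Num.sqrt (\sum_(i < n) x i ord0 ^+ 2).

Definition is_min_eigenvalue (R : realType) (n : nat) (A : 'M[R]_n) (l : R) : Prop :=
  eigenvalue A l /\ forall mu : R, eigenvalue A mu -> l <= mu.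

(* Column eigenvectors; [eigenvalue] is defined through row vectors, which
   makes no difference for a symmetric A. *)
Definition is_eigenvector (R : realType) (n : nat) (A : 'M[R]_n) (l : R)
    (v : 'cV[R]_n) : Prop :=
  v != 0 /\ A *m v = l *: v.

Definition is_optimal_solution (R : realType) (T : Type) (D : set T) (f : T -> R)
    (x : T) : Prop :=
  D x /\ forall z : T, D z -> f x <= f z.

(* Extended-real infimum, so that no boundedness assumption is built in. *)
Definition optimal_value (R : realType) (T : Type) (D : set T) (f : T -> R) : \bar R :=
  ereal_inf [set (f x)%:E | x in D].

Definition f1 (R : realType) (n : nat) (A : 'M[R]_n) (b : 'cV[R]_n) (rho : R)
    (x : 'cV[R]_n) : R :=
  1 / 2 * (x^T *m A *m x) ord0 ord0 + (b^T *m x) ord0 ord0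
  + rho / 3 * enorm x ^+ 3.

Definition f2 (R : realType) (n : nat) (A : 'M[R]_n) (b : 'cV[R]_n) (rho l1 : R)
    (p : 'cV[R]_n * R) : R :=
  1 / 2 * (p.1^T *m (A - l1%:M) *m p.1) ord0 ord0 + (b^T *m p.1) ord0 ord0
  + rho / 3 * p.2 `^ (3 / 2) + l1 / 2 * p.2.

Definition CP_feasible (R : realType) (n : nat) : set ('cV[R]_n * R) :=
  [set p | enorm p.1 ^+ 2 <= p.2].
Arguments CP_feasible : clear implicits.

Definition CRS_optimal (R : realType) (n : nat) (A : 'M[R]_n) (b : 'cV[R]_n) (rho : R)
    (x : 'cV[R]_n) : Prop :=
  is_optimal_solution setT (f1 A b rho) x.

Definition CP_optimal (R : realType) (n : nat) (A : 'M[R]_n) (b : 'cV[R]_n) (rho l1 : R)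
    (p : 'cV[R]_n * R) : Prop :=
  is_optimal_solution (CP_feasible R n) (f2 A b rho l1) p.

(* Main.v *)
(* Since (A - l1 I) v = 0 for an eigenvector v,
   moving x along v changes f2 only through the linear term b^T v, so a feasible
   point can be pushed, in the direction where b^T v does not increase, until
   |x|^2 = y, and on that paraboloid f2 (x, |x|^2) = f1 x.  At an optimal point
   with |x|^2 < y both directions are available, which forces b^T v = 0. *)
Require Import Defs.
From HB Require Import structures.
From mathcomp Require Import all_boot all_order all_algebra.
From mathcomp Require Import all_classical all_reals all_analysis.
From mathcomp Require Import ring.

Set Implicit Arguments.
Unset Strict Implicit.
Unset Printing Implicit Defensive.

Import Order.TTheory GRing.Theory Num.Theory.

Local Open Scope classical_set_scope.
Local Open Scope ring_scope.

Lemma enorm_ge0 (R : realType) (n : nat) (x : 'cV[R]_n) : 0 <= enorm x.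
Proof. exact: sqrtr_ge0. Qed.

Lemma enorm_sqrE (R : realType) (n : nat) (x : 'cV[R]_n) :
  enorm x ^+ 2 = (x^T *m x) ord0 ord0.
Proof.
rewrite sqr_sqrtr; last by apply: sumr_ge0 => i _; apply: sqr_ge0.
by rewrite mxE; apply: eq_bigr => i _; rewrite mxE expr2.
Qed.

Lemma enorm_sqr_gt0 (R : realType) (n : nat) (x : 'cV[R]_n) :
  x != 0 -> 0 < enorm x ^+ 2.
Proof.
move=> x0; rewrite lt_def sqr_ge0 andbT; apply: contra x0.
rewrite sqr_sqrtr; last by apply: sumr_ge0 => i _; apply: sqr_ge0.
rewrite psumr_eq0 => [/allP x0|i _]; last exact: sqr_ge0.
apply/eqP/colP => i; rewrite mxE.
by have := x0 i (mem_index_enum i); rewrite sqrf_eq0 => /eqP.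
Qed.

Lemma mulmx_trC (R : realType) (n : nat) (x y : 'cV[R]_n) :
  (x^T *m y) ord0 ord0 = (y^T *m x) ord0 ord0.
Proof. by rewrite !mxE; apply: eq_bigr => i _; rewrite !mxE mulrC. Qed.

Lemma enorm_sqr_line (R : realType) (n : nat) (x v : 'cV[R]_n) (z : R) :
  enorm (x + z *: v) ^+ 2
  = enorm x ^+ 2 + 2 * z * (x^T *m v) ord0 ord0 + z ^+ 2 * enorm v ^+ 2.
Proof.
rewrite !enorm_sqrE [(x + z *: v)^T]linearD /= [(z *: v)^T]linearZ /= mulmxDl !mulmxDr.
rewrite -!scalemxAl -!scalemxAr.
move: (x^T *m x) (x^T *m v) (v^T *m x) (v^T *m v) (mulmx_trC v x) => p q r s rq.
rewrite !mxE rq; ring.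
Qed.

(** As a quadratic in [z], the equation has leading coefficient [enorm v ^+ 2 > 0] and constant term
    [enorm x ^+ 2 - y <= 0], so its larger root is real and nonnegative. The sign of [z] is what
    later fixes the sign of the change in [f2]. *)
Lemma enorm_sqr_line_root (R : realType) (n : nat) (x v : 'cV[R]_n) (y : R) :
  v != 0 -> enorm x ^+ 2 <= y ->
  exists2 z : R, 0 <= z & enorm (x + z *: v) ^+ 2 = y.
Proof.
move=> /enorm_sqr_gt0 a_gt0 xy.
set a := enorm v ^+ 2 in a_gt0; set h := (x^T *m v) ord0 ord0.
(* A quarter of the discriminant of [a * z ^+ 2 + 2 * h * z + (enorm x ^+ 2 - y)]. *)
set d := h ^+ 2 + a * (y - enorm x ^+ 2).
have hd : h ^+ 2 <= d by rewrite lerDl mulr_ge0 ?subr_ge0// ltW.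
have d_ge0 : 0 <= d by apply: le_trans hd; apply: sqr_ge0.
exists ((Num.sqrt d - h) / a).
  rewrite divr_ge0 ?(ltW a_gt0)// subr_ge0.
  by apply: le_trans (ler_norm h) _; rewrite -sqrtr_sqr ler_wsqrtr.
rewrite enorm_sqr_line -/a -/h.
(* Eliminating [enorm x ^+ 2] in favour of [d], then writing [d] as the square of its root, leaves a
   rational identity in [Num.sqrt d]. *)
have -> : enorm x ^+ 2 = y - (d - h ^+ 2) / a.
  by rewrite /d; field; rewrite gt_eqF.
rewrite -[in d - _](sqr_sqrtr d_ge0); by field; rewrite gt_eqF.
Qed.

Lemma powR_sqr_3half (R : realType) (e : R) :
  0 <= e -> (e ^+ 2) `^ (3 / 2) = e ^+ 3.
Proof.
move=> e0; rewrite -!powR_mulrn// -powRrM; congr (_ `^ _); by field.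
Qed.

(** The shift by [l1] subtracts [l1 / 2 * enorm x ^+ 2] from the quadratic form, and the term
    [l1 / 2 * y] restores it when [y = enorm x ^+ 2]. *)
Lemma f2_paraboloid (R : realType) (n : nat) (A : 'M[R]_n) (b : 'cV[R]_n)
    (rho l1 : R) (x : 'cV[R]_n) :
  f2 A b rho l1 (x, enorm x ^+ 2) = f1 A b rho x.
Proof.
rewrite /f2 /f1 /= powR_sqr_3half ?enorm_ge0//.
rewrite mulmxBr mulmxBl mul_mx_scalar -scalemxAl enorm_sqrE.
move: (x^T *m A *m x) (x^T *m x) => p q; rewrite !mxE; by field.
Qed.

Lemma f2_line (R : realType) (n : nat) (A : 'M[R]_n) (b : 'cV[R]_n)
    (rho l1 : R) (x v : 'cV[R]_n) (y z : R) :
  A^T = A -> A *m v = l1 *: v ->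
  f2 A b rho l1 (x + z *: v, y)
  = f2 A b rho l1 (x, y) + z * (b^T *m v) ord0 ord0.
Proof.
move=> A_sym Av; rewrite /f2 /=.
set M := A - l1%:M.
have Mv : M *m v = 0 by rewrite mulmxBl Av mul_scalar_mx subrr.
(* Symmetry puts [v] in the left kernel of [M] too, so both cross terms and the square term of the
   form vanish. *)
have vM : v^T *m M = 0.
  by apply: trmx_inj; rewrite trmx_mul trmxK linearB /= A_sym tr_scalar_mx Mv trmx0.
have -> : (x + z *: v)^T *m M *m (x + z *: v) = x^T *m M *m x.
  rewrite [(x + z *: v)^T]linearD /= [(z *: v)^T]linearZ /= mulmxDl -scalemxAl vM scaler0 addr0.
  by rewrite mulmxDr -scalemxAr -(mulmxA _ M v) Mv mulmx0 scaler0 addr0.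
rewrite [b^T *m _]mulmxDr -scalemxAr; move: (b^T *m x) (b^T *m v) => p q.
rewrite [(p + _) _ _]mxE [(z *: q) _ _]mxE; ring.
Qed.

(** Holding at every feasible point, this comparison serves both the equality of optimal values and
    (2). *)
Lemma f1_le_f2 (R : realType) (n : nat) (A : 'M[R]_n) (b : 'cV[R]_n)
    (rho l1 : R) (p : 'cV[R]_n * R) :
  A^T = A -> eigenvalue A l1 -> CP_feasible R n p ->
  exists x, f1 A b rho x <= f2 A b rho l1 p.
Proof.
case: p => x y A_sym /eigenvalueP[u uA u0] /= xy.
(* The row eigenvector [u] is transposed by symmetry of [A] and negated if necessary, so that a step
   [z >= 0] along it cannot increase [f2]. *)
have [v [v0 Av] bv] : exists2 v, is_eigenvector A l1 v & (b^T *m v) ord0 ord0 <= 0.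
  have u_eig : is_eigenvector A l1 u^T.
    split; first by rewrite trmx_eq0.
    by apply: trmx_inj; rewrite trmx_mul trmxK A_sym uA linearZ /= trmxK.
  have [|bu] := leP ((b^T *m u^T) ord0 ord0) 0; first by exists u^T.
  case: u_eig => u0' Au; exists (- u^T).
    by split; [rewrite oppr_eq0 | rewrite mulmxN Au scalerN].
  by rewrite mulmxN mxE oppr_le0 ltW.
have [z z_ge0 zy] := enorm_sqr_line_root v0 xy.
exists (x + z *: v).
by rewrite -(f2_paraboloid A b rho l1) zy f2_line// gerDl mulr_ge0_le0.
Qed.

Lemma CP_optimal_interior (R : realType) (n : nat) (A : 'M[R]_n)
    (b : 'cV[R]_n) (rho l1 : R) (x v : 'cV[R]_n) (y : R) :
  A^T = A -> CP_optimal A b rho l1 (x, y) -> enorm x ^+ 2 < y ->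
  is_eigenvector A l1 v -> (b^T *m v) ord0 ord0 = 0.
Proof.
move=> A_sym [_ opt] xy.
have bw_ge0 w : is_eigenvector A l1 w -> 0 <= (b^T *m w) ord0 ord0.
  move=> [w0 Aw]; have [z z_ge0 zy] := enorm_sqr_line_root w0 (ltW xy).
  (* A zero step would put [x] on the paraboloid, against the strict inequality; with [z > 0],
     optimality yields the sign of [b^T *m w]. *)
  have z_gt0 : 0 < z.
    rewrite lt_def z_ge0 andbT; apply/eqP => z0.
    by move: xy; rewrite -zy z0 scale0r addr0 ltxx.
  have /opt : CP_feasible R n (x + z *: w, y) by rewrite /CP_feasible /= zy.
  by rewrite f2_line// lerDl pmulr_rge0.
move=> v_eig; apply/le_anti; rewrite bw_ge0// andbT -oppr_ge0.
have := bw_ge0 (- v); rewrite mulmxN mxE; apply.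
by case: v_eig => v0 Av; split; [rewrite oppr_eq0 | rewrite mulmxN Av scalerN].
Qed.

Theorem theorem2p1 (R : realType) (n : nat) (A : 'M[R]_n) (b : 'cV[R]_n)
    (rho l1 : R)
    (A_sym : A^T = A)
    (l1_min : is_min_eigenvalue A l1)
    (l1_lt0 : l1 < 0)
    (rho_gt0 : 0 < rho) :
  [/\ optimal_value setT (f1 A b rho)
        = optimal_value (CP_feasible R n) (f2 A b rho l1),
      forall xs : 'cV[R]_n, CRS_optimal A b rho xs ->
        CP_optimal A b rho l1 (xs, enorm xs ^+ 2)
    & forall (xt : 'cV[R]_n) (yt : R), CP_optimal A b rho l1 (xt, yt) ->
        (enorm xt ^+ 2 = yt -> CRS_optimal A b rho xt)
        /\ (enorm xt ^+ 2 < yt ->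
            forall v : 'cV[R]_n, is_eigenvector A l1 v ->
              (exists zeta : R, enorm (xt + zeta *: v) ^+ 2 = yt)
              /\ (forall zeta : R, enorm (xt + zeta *: v) ^+ 2 = yt ->
                    CRS_optimal A b rho (xt + zeta *: v)))].
Proof.
have [l1_eig _] := l1_min.
have paraboloid_feasible x : CP_feasible R n (x, enorm x ^+ 2).
  exact: lexx.
split.
- apply/le_anti/andP; split; apply: le_ereal_inf_tmp => _ [p Dp <-].
  + have [x f1x] := f1_le_f2 b rho A_sym l1_eig Dp.
    apply: (@le_trans _ _ (f1 A b rho x)%:E); last by rewrite lee_fin.
    by apply: ereal_inf_lbound; exists x.
  + apply: ereal_inf_lbound; exists (p, enorm p ^+ 2) => //.
    by rewrite f2_paraboloid.
- move=> xs [_ opt]; split => // p Dp.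
  have [x f1x] := f1_le_f2 b rho A_sym l1_eig Dp.
  by rewrite f2_paraboloid; apply: le_trans f1x; apply: opt.
- move=> xt yt CPopt; have [_ opt] := CPopt; split.
  + move=> xy; split => // x _.
    (* Both values of [f1] are lifted to the paraboloid, where optimality for (CP) compares them. *)
    by rewrite -!(f2_paraboloid _ _ _ l1) xy; apply: opt.
  + move=> xy v v_eig; have [v0 Av] := v_eig; split.
      by have [z _ zy] := enorm_sqr_line_root v0 (ltW xy); exists z.
    move=> z zy; split => // x _.
    (* Either root will do: [b^T *m v] vanishes here, so [f2] is constant along the line at height
       [yt]. *)
    rewrite -!(f2_paraboloid _ _ _ l1) zy f2_line//.
    rewrite (CP_optimal_interior A_sym CPopt xy v_eig) mulr0 addr0.
    exact: opt.
Qed.
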